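(* Let $N\ge k_p+k_q$ and consider the (two-sided) reflecting random leap on $\{0,\dots,N\}$. Then $\sum_{j=0}^N\det(\mathbf W_j)\neq 0$ and its unique stationary distribution $\boldsymbol\pi=(\pi_0,\dots,\pi_N)$ is given by \[ \pi_i=\frac{\det(\mathbf W_i)}{\sum_{j=0}^N\det(\mathbf W_j)},\qquad i\in\{0,\dots,N\}. \]
   Context: Fix an integer $k\ge1$ and nonnegative reals $p_1,\dots,p_k,q_1,\dots,q_k$ with $\sum_{j=1}^k(p_j+q_j)=1$, $\sum_{j=1}^k p_j>0$, $\sum_{j=1}^k q_j>0$, and $\gcd\{j:p_j+q_j>0\}=1$. Let $k_p=\max\{j:p_j>0\}$, $k_q=\max\{j:q_j>0\}$, $r=k_p+k_q-1$. Let $\xi$ be a random variable with $P(\xi=\ell)=p_\ell$, $P(\xi=-\ell)=q_\ell$ ($1\le\ell\le k$). The reflecting random leap on $\{0,\dots,N\}$ is the Markov chain with, for every $i\in\{0,\dots,N\}$: $P(i\to0)=P(i+\xi\le0)$, $P(i\to j)=P(i+\xi=j)$ for $1\le j\le N-1$, $P(i\to N)=P(i+\xi\ge N)$. Reverse characteristic polynomial: $\psi(z)=\sum_{j=0}^{2k-1}\gamma_jz^j$, $\gamma_j=-\sum_{\ell=k-j}^k p_\ell$ for $0\le j\le k-1$, $\gamma_j=\sum_{\ell=j-k+1}^k q_\ell$ for $k\le j\le 2k-1$. Counted with multiplicity $\psi$ has exactly $r$ nonzero roots. Let $y_1,\dots,y_s$ be its distinct nonzero roots, listed in ascending order of absolute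 value (ties broken arbitrarily), with multiplicities $r_1,\dots,r_s$. For each $j$ let $\mathbf Y^{(j)}$ be the $(N+r-1)\times r_j$ matrix with entries $Y^{(j)}_{i,\ell}=(i+1-k_p)^{\ell-1}y_j^{\,i+1-k_p}$ ($1\le i\le N+r-1$, $1\le\ell\le r_j$), with $0^0=1$, and $\mathbf Y=(\mathbf Y^{(1)}\ \cdots\ \mathbf Y^{(s)})$, an $(N+r-1)\times r$ matrix. Modified accordion matrix: for $i\in\{0,\dots,N\}$, $\mathbf A^\dagger_i$ is the $r\times(N+r-1)$ matrix $\begin{pmatrix}I_{k_p-1}&0&0&0\\0&\mathbf 1_i^T&\mathbf 0_{N-i+1}^T&0\\0&\mathbf 0_i^T&\mathbf 1_{N-i+1}^T&0\\0&0&0&I_{k_q-2}\end{pmatrix}$ if $k_q\ge2$ (column blocks of widths $k_p-1,i,N-i+1,k_q-2$), and $\begin{pmatrix}I_{k_p-1}&0&0\\0&\mathbf 1_i^T&\mathbf 0_{N-i}^T\end{pmatrix}$ if $k_q=1$. Let $\boldsymbol\eta$ be the vector of length $N+r-1$ with $\eta_j=\sum_{\ell=j-k_p+1}^{k_q}(\ell-j+k_p)q_\ell$ for $k_p\le j\le r$ and $\eta_j=0$ otherwise. For $i\in\{0,\dots,N\}$ let $\mathbf W_i$ be the $(r+1)\times(r+1)$ matrix $\mathbf W_i=\begin{pmatrix}\mathbf A_i^\dagger\mathbf Y & \mathbf e_{k_p-1}-\mathbf e_{k_p}\\ \boldsymbol\eta^T\mathbf Y & \sum_{\ell=1}^{k_p}p_\ell-\sum_{\ell=1}^{k_q}\ell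 q_\ell\end{pmatrix}$, where $\mathbf e_m$ is the $m$-th unit vector of length $r$ and $\mathbf e_{k_p-1}$ is the zero vector if $k_p=1$. *)

(* Defs.v *)
From HB Require Import structures.
From mathcomp Require Import all_boot all_order all_algebra.
Set Implicit Arguments. Unset Strict Implicit. Unset Printing Implicit Defensive.
Import Order.TTheory GRing.Theory Num.Theory.
Local Open Scope ring_scope.

(* Scalars live in a numeric algebraically closed field C
   (e.g. algC); probabilities p_l, q_l are elements x with 0 <= x (hence real).
   p q : nat -> C, only the values at l = 1..k are ever used. *)

Section Leap.
Variables (C : numClosedFieldType) (k : nat) (p q : nat -> C).

Definition kp : nat := \max_(1 <= j < k.+1 | 0 < p j) j.
Definition kq : nat := \max_(1 <= j < k.+1 | 0 < q j) j.
Definition rr : nat := (kp + kq).-1.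

Definition xi_prob (S : int -> bool) : C :=
  \sum_(1 <= l < k.+1) ((S (Posz l))%:R * p l + (S (- Posz l))%:R * q l).

Definition leap_P (N : nat) : 'M[C]_(N.+1) :=
  \matrix_(i < N.+1, j < N.+1)
    if (j : nat) == 0%N then xi_prob (fun x => Posz i + x <= 0)
    else if (j : nat) == N then xi_prob (fun x => Posz N <= Posz i + x)
    else xi_prob (fun x => Posz i + x == Posz j).

Definition stationary (N : nat) (pi : 'rV[C]_(N.+1)) : Prop :=
  (forall i, 0 <= pi 0 i) /\ \sum_i pi 0 i = 1 /\ pi *m leap_P N = pi.

Definition gamma (j : nat) : C :=
  if (j < k)%N then - \sum_(k - j <= l < k.+1) p l
  else \sum_(j - k + 1 <= l < k.+1) q l.

Definition psi : {poly C} := \poly_(j < (2 * k)%N) gamma j.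

(* Columns of Y: for the list ys = (y_1,...,y_s) of distinct nonzero roots,
   the pairs (y_j, l-1) for l = 1..r_j, in order (block Y^(1), ..., Y^(s)). *)
Definition Ycols (ys : seq C) : seq (C * nat) :=
  flatten [seq [seq (y, l) | l <- iota 0 (mup y psi)] | y <- ys].

(* Y : (N+r-1) x r ; 0-based row i0 corresponds to the paper's row i = i0+1,
   entry (i+1-k_p)^(l-1) * y^(i+1-k_p), with 0^0 = 1 (int exponent for y). *)
Definition Ymx (N : nat) (ys : seq C) : 'M[C]_((N + rr).-1, rr) :=
  \matrix_(i0 < (N + rr).-1, c < rr)
    let yl := nth (0, 0%N) (Ycols ys) c in
    let e : int := Posz i0.+2 - Posz kp in
    (e%:~R) ^+ yl.2 * yl.1 ^ e.

(* modified accordion matrix A^dagger_i, 0-based (row a, column b).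
   Rows 1..k_p-1 : identity; row k_p : ones on the block of width i;
   (if k_q >= 2) row k_p+1 : ones on the block of width N-i+1;
   rows k_p+2..r : identity on the last k_q-2 columns.
   When k_q = 1 we have r = k_p and only the first two kinds of rows occur. *)
Definition Adag (N i : nat) : 'M[C]_(rr, (N + rr).-1) :=
  \matrix_(a < rr, b < (N + rr).-1)
    (if (a < kp.-1)%N then (b == a :> nat)
     else if (a == kp.-1 :> nat) then (kp.-1 <= b < kp.-1 + i)%N
     else if (a == kp :> nat) then (kp.-1 + i <= b < kp + N)%N
     else (b == (a + N - 1)%N :> nat))%:R.

Definition eta (N : nat) : 'rV[C]_((N + rr).-1) :=
  \row_(j0 < (N + rr).-1)
    let j := j0.+1 in
    if (kp <= j <= rr)%N then
      \sum_(j - kp + 1 <= l < kq.+1) (l + kp - j)%:R * q l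
    else 0.

(* e_{k_p-1} - e_{k_p} (e_0 := 0), as a column of length r *)
Definition evec : 'cV[C]_rr :=
  \col_(a < rr) (((1 < kp)%N && (a == kp.-2 :> nat))%:R - (a == kp.-1 :> nat)%:R).

Definition Wcorner : C :=
  \sum_(1 <= l < kp.+1) p l - \sum_(1 <= l < kq.+1) l%:R * q l.

Definition Wmx (N : nat) (ys : seq C) (i : nat) : 'M[C]_(rr + 1) :=
  block_mx (Adag N i *m Ymx N ys) evec
           (eta N *m Ymx N ys) Wcorner%:M.

End Leap.

(* Main.v *)
Require Import Defs.
From HB Require Import structures.
From mathcomp Require Import all_boot all_order all_algebra.
From mathcomp Require Import zify ring.
Import Order.TTheory GRing.Theory Num.Theory.
Local Open Scope ring_scope.
Set Implicit Arguments. Unset Strict Implicit. Unset Printing Implicit Defensive.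

(* Let [x] be a combination of the columns of [Ymx], read as a sequence indexed
   by the integers, let [t] be the last coordinate of a vector of length
   [rr + 1], and let [level] be the sequence with increments [x] and value [-t]
   at [0].  After adding row [kp - 1] to row [kp] (rows counted from 0), only
   row [kp - 1] of [W i] depends on [i]; its product with the vector is the
   level at [i].  The other rows say that the level vanishes on the [kp - 1]
   sites left of [0] and the [kq - 1] sites right of [N], and that the flow
   across the edge between the sites 0 and 1 balances.  Since [x] satisfies the
   recurrence with characteristic polynomial [psi], the flow then balances across
   every edge, so the level is an invariant measure of the chain.  The chain can
   always move down, so an invariant measure of total mass zero vanishes; as the
   columns of [Ymx] are free (confluent Vandermonde), the matrix whose row
   [kp - 1] is the sum of those of the [W i] is invertible.  Its determinant is the sum of the
   [\det (W i)], and the cofactors along row [kp - 1] form a solution whose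
   level at [i] is [\det (W i)]. *)

(** * Invariant vectors of a stochastic matrix that can always move down *)

Section Markov.
Variables (C : numClosedFieldType) (n : nat) (P : 'M[C]_n.+1).
Hypothesis P_ge0 : forall i j, 0 <= P i j.
Hypothesis P_sum1 : forall i, \sum_j P i j = 1.
Hypothesis P_down : forall i : 'I_n.+1, (0 < i)%N ->
  exists2 j : 'I_n.+1, (j < i)%N & 0 < P i j.

(** The triangle inequality gives [|v| <= |v| P] entrywise; both sides have the same total because
    the rows of [P] sum to 1, so every gap is zero. *)
Lemma invariant_norm (v : 'rV[C]_n.+1) :
  v *m P = v -> map_mx Num.norm v *m P = map_mx Num.norm v.
Proof.
move=> vP; apply/rowP => j; rewrite !mxE.
have le_v i : `|v 0 i| <= \sum_k `|v 0 k| * P k i.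
  rewrite -[in X in X <= _]vP mxE (le_trans (ler_norm_sum _ _ _)) //.
  by apply: ler_sum => k _; rewrite normrM (ger0_norm (P_ge0 k i)).
have sum_eq : \sum_i (\sum_k `|v 0 k| * P k i - `|v 0 i|) = 0.
  rewrite sumrB exchange_big /=.
  under eq_bigr => k _ do rewrite -mulr_sumr P_sum1 mulr1.
  by rewrite subrr.
under eq_bigr => k _ do rewrite mxE.
apply/eqP; rewrite -subr_eq0; apply/eqP.
by apply: (psumr_eq0P _ sum_eq) => // i _; rewrite subr_ge0.
Qed.

(** Zeros spread upwards: if [|v|] vanishes at [j], invariance makes it vanish at every site with a
    positive probability of moving to [j]. *)
Lemma invariant_eq0 (v : 'rV[C]_n.+1) : v *m P = v -> v 0 0 = 0 -> v = 0.
Proof.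
move=> vP v00; have aP := invariant_norm vP.
have v0 m : forall i : 'I_n.+1, (i <= m)%N -> v 0 i = 0.
  elim: m => [|m IHm] i.
    by rewrite leqn0 => /eqP i0; rewrite -v00; congr (v _ _); apply: val_inj.
  case: (posnP i) => [i0 _|i_gt0 le_im].
    by rewrite -v00; congr (v _ _); apply: val_inj.
  have [j lt_ji Pij] := P_down i_gt0.
  have /rowP/(_ j) := aP; rewrite !mxE (IHm j) ?normr0; last first.
    by rewrite -ltnS (leq_trans lt_ji).
  move/(psumr_eq0P _)/(_ i isT); rewrite mxE.
  move=> /(_ _)/eqP; rewrite mulf_eq0 (gt_eqF Pij) orbF normr_eq0.
  move=> v_i0; apply/eqP/v_i0 => k _.
  by rewrite mxE mulr_ge0.
by apply/rowP => i; rewrite (v0 i) ?mxE.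
Qed.

(* [|v_0| v - v_0 |v|] is invariant and vanishes at 0, so [v] is a multiple of
   [|v|]. *)
Lemma invariant_sum_eq0 (v : 'rV[C]_n.+1) :
  v *m P = v -> \sum_i v 0 i = 0 -> v = 0.
Proof.
move=> vP sv; apply: invariant_eq0 => //; apply/eqP/negPn/negP => v00.
have aP := invariant_norm vP.
pose u := `|v 0 0| *: v - v 0 0 *: map_mx Num.norm v.
have u0 : u = 0.
  apply: invariant_eq0; first by rewrite mulmxBl -!scalemxAl vP aP.
  by rewrite !mxE mulrC subrr.
have : \sum_i u 0 i = 0 by rewrite u0 big1 // => i _; rewrite mxE.
under eq_bigr => i _ do rewrite !mxE.
rewrite sumrB -!mulr_sumr sv mulr0 sub0r => /eqP.
rewrite oppr_eq0 mulf_eq0 (negPf v00) /= => /eqP s0.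
have /(_ 0 isT)/eqP := psumr_eq0P (fun i _ => normr_ge0 (v 0 i)) s0.
by rewrite normr_eq0 (negPf v00).
Qed.

(** With [s] the mass of [|v|], the invariant vectors [|v|] and [s v] have equal mass, hence
    coincide, and [s > 0]. *)
Lemma invariant_sum1_ge0 (v : 'rV[C]_n.+1) :
  v *m P = v -> \sum_i v 0 i = 1 -> forall i, 0 <= v 0 i.
Proof.
move=> vP sv i; pose s := \sum_i `|v 0 i|.
have s_ge1 : 1 <= s by rewrite -(@normr1 C) -sv ler_norm_sum.
have s_gt0 : 0 < s by apply: lt_le_trans s_ge1.
have /rowP/(_ i) : map_mx Num.norm v - s *: v = 0.
  apply: invariant_sum_eq0; first by rewrite mulmxBl -scalemxAl vP invariant_norm.
  under eq_bigr => j _ do rewrite !mxE.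
  by rewrite sumrB -mulr_sumr sv mulr1 subrr.
rewrite !mxE => /eqP; rewrite subr_eq0 => /eqP vi.
by rewrite -(pmulr_rge0 _ s_gt0) -vi.
Qed.

End Markov.

(** * Square matrices that agree outside one row *)

Section CramerFamily.
Variables (F : fieldType) (n m : nat) (M : 'I_m.+1 -> 'M[F]_n) (i0 : 'I_n).
Hypothesis M_agree : forall a, a != i0 -> forall i j b, M i a b = M j a b.
Hypothesis M_inj : forall w : 'cV[F]_n,
  (forall i a, a != i0 -> (M i *m w) a 0 = 0) ->
  \sum_i (M i *m w) i0 0 = 0 -> w = 0.

Let cofactor_agree (A B : 'M[F]_n) : (forall a, a != i0 -> forall b, A a b = B a b) ->
  forall b, cofactor A i0 b = cofactor B i0 b.
Proof.
move=> AB b; congr (_ * \det _); apply/matrixP => a c.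
by rewrite !mxE AB // eq_sym neq_lift.
Qed.

(** The cofactors along row [i0] do not see that row, so one vector serves all [i]; Laplace
    expansion gives the determinant in row [i0] and zero in the others. *)
Lemma family_cofactor : exists2 v : 'cV[F]_n,
  (forall i a, a != i0 -> (M i *m v) a 0 = 0) &
  (forall i, (M i *m v) i0 0 = \det (M i)).
Proof.
pose v : 'cV[F]_n := \col_b cofactor (M 0) i0 b.
have vE i b : v b 0 = \adj (M i) b i0.
  by rewrite !mxE; apply: cofactor_agree => a ai0 c; apply: M_agree.
have MvE i a : (M i *m v) a 0 = (\det (M i))%:M a i0.
  by rewrite -mul_mx_adj !mxE; apply: eq_bigr => b _; rewrite (vE i).
exists v => [i a ai0|i]; rewrite MvE mxE ?eqxx //.
by rewrite (negPf ai0).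
Qed.

(** By linearity in row [i0] the sum is the determinant of the matrix [B] whose row [i0] is the sum
    of those rows; [M_inj] says that [B] has trivial kernel. *)
Lemma family_det_sum_neq0 : \sum_i \det (M i) != 0.
Proof.
pose B := \matrix_(a, b) if a == i0 then \sum_i M i a b else M 0 a b.
have detB : \det B = \sum_i \det (M i).
  rewrite (expand_det_row B i0).
  under eq_bigr => b _ do rewrite mxE eqxx mulr_suml.
  rewrite exchange_big /=; apply: eq_bigr => i _.
  rewrite (expand_det_row (M i) i0); apply: eq_bigr => b _; congr (_ * _).
  by apply: cofactor_agree => a ai0 c; rewrite mxE (negPf ai0); apply: M_agree.
rewrite -detB -det_tr; apply/det0P => -[u u0 uB].
have Bu : B *m u^T = 0 by rewrite -[B]trmxK -trmx_mul uB trmx0.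
case/eqP: u0; apply: trmx_inj; rewrite trmx0; apply: M_inj.
  move=> i a ai0; transitivity ((B *m u^T) a 0); last by rewrite Bu mxE.
  rewrite !mxE; apply: eq_bigr => b _; rewrite [B a b]mxE (negPf ai0).
  by rewrite (M_agree ai0 i 0).
transitivity ((B *m u^T) i0 0); last by rewrite Bu mxE.
under eq_bigr => i _ do rewrite mxE.
rewrite mxE exchange_big /=; apply: eq_bigr => b _.
by rewrite !mxE eqxx mulr_suml.
Qed.

End CramerFamily.

(** * Exponential polynomials and the confluent Vandermonde matrix *)

Section ExponentialPolynomials.
Variable C : numClosedFieldType.
Implicit Types (f g : {poly C}) (y a : C).

(** The Euler operator shifted by [a]: it scales the coefficient of index [i] by [i + a], so its
    iterates produce the polynomial factors of the columns. *)
Definition theta a f := 'X * f^`() + a *: f.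

Lemma coef_theta a f i : (theta a f)`_i = (i%:R + a) * f`_i.
Proof.
rewrite coefD coefZ coefXM coef_deriv; case: i => [|i] /=; first by rewrite !add0r.
by rewrite mulrDl mulr_natl.
Qed.

Lemma coef_iter_theta a f l i :
  (iter l (theta a) f)`_i = (i%:R + a) ^+ l * f`_i.
Proof.
by elim: l => [|l IHl]; rewrite ?mul1r //= coef_theta IHl exprS mulrA.
Qed.

(** Each application of [theta] lowers the order of vanishing at [y] by one; the new cofactor at [y]
    is [(m + 1) y h(y)], nonzero in characteristic 0 when [y] and [h(y)] are. *)
Lemma iter_theta_XsubC a y g l m : exists2 h,
  iter l (theta a) (('X - y%:P) ^+ (m + l) * g) = ('X - y%:P) ^+ m * h &
  y != 0 -> g.[y] != 0 -> h.[y] != 0.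
Proof.
elim: l m => [|l IHl] m; first by exists g; rewrite ?addn0.
have [h IH h0] := IHl m.+1.
exists (m.+1%:R *: ('X * h) + ('X - y%:P) * theta a h).
  rewrite iterS -addSnnS IH /theta derivM deriv_exp derivXsubC mul1r /=.
  rewrite exprS -!mul_polyC polyC_natr -mulr_natl.
  ring.
move=> y0 gy; rewrite !hornerE subrr mul0r addr0 !mulf_neq0 ?h0 //.
by rewrite pnatr_eq0.
Qed.

Lemma sum_exponential f y (e0 : int) l n : y != 0 -> (size f <= n)%N ->
  \sum_(i < n) f`_i * ((e0 + Posz i)%:~R ^+ l * y ^ (e0 + Posz i)) =
  y ^ e0 * (iter l (theta e0%:~R) f).[y].
Proof.
move=> y0 szf; rewrite (@horner_coef_wide _ n).
  rewrite mulr_sumr; apply: eq_bigr => i _.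
  rewrite coef_iter_theta expfzDr // -exprnP rmorphD /= addrC -pmulrn.
  ring.
apply/leq_sizeP => i le_ni; rewrite coef_iter_theta nth_default ?mulr0 //.
exact: leq_trans le_ni.
Qed.

Lemma sum_exponential_root f y (e0 : int) l n : y != 0 -> (size f <= n)%N ->
  (l < mup y f)%N ->
  \sum_(i < n) f`_i * ((e0 + Posz i)%:~R ^+ l * y ^ (e0 + Posz i)) = 0.
Proof.
move=> y0 szf ltl; rewrite sum_exponential //.
have [->|f0] := eqVneq f 0.
  rewrite (_ : iter _ _ _ = 0) ?horner0 ?mulr0 //; apply/polyP => i.
  by rewrite coef_iter_theta !coef0 mulr0.
move: (ltl); rewrite mup_geq // => /dvdpP[g ->].
have [h] := iter_theta_XsubC e0%:~R y g l 1.
by rewrite add1n [_ * g]mulrC => -> _; rewrite expr1 hornerM hornerXsubC subrr mul0r mulr0.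
Qed.

Definition exp_cols (mu : C -> nat) (ys : seq C) : seq (C * nat) :=
  flatten [seq [seq (y, l) | l <- iota 0 (mu y)] | y <- ys].

Lemma mem_exp_cols mu ys yl :
  yl \in exp_cols mu ys = (yl.1 \in ys) && (yl.2 < mu yl.1)%N.
Proof.
case: yl => y l; apply/flatten_mapP/andP => /= [[z zys /mapP[j]]|[yys lt_l]].
  by rewrite mem_iota => /andP[_ lt_j] [-> ->].
by exists y => //; apply/mapP; exists l => //; rewrite mem_iota.
Qed.

Lemma size_exp_cols mu ys : size (exp_cols mu ys) = (\sum_(y <- ys) mu y)%N.
Proof.
rewrite size_flatten /shape -map_comp sumnE big_map; apply: eq_bigr => y _.
by rewrite /= size_map size_iota.
Qed.

Lemma uniq_exp_cols mu ys : uniq ys -> uniq (exp_cols mu ys).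
Proof.
elim: ys => //= y ys IHys /andP[yys uys].
rewrite /exp_cols /= cat_uniq -/(exp_cols mu ys) IHys // andbT.
rewrite map_inj_uniq ?iota_uniq => [/=|i j [] //].
apply/hasPn => yl; rewrite mem_exp_cols => /andP[y1 _].
apply/mapP => -[j _ yl_j]; rewrite yl_j /= in y1.
by rewrite y1 in yys.
Qed.

Definition exp_term (yl : C * nat) (e : int) : C := e%:~R ^+ yl.2 * yl.1 ^ e.

(* Confluent Vandermonde: pairing a vanishing combination with the coefficients
   of [('X - y)^l \prod_(z != y) ('X - z)^(mu z)] isolates the term [(y, l)],
   provided [l] is maximal among the terms that occur. *)
Lemma exp_cols_free mu ys (e0 : int) n (w : 'I_(size (exp_cols mu ys)) -> C) :
  uniq ys -> 0 \notin ys -> (size (exp_cols mu ys) <= n)%N ->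
  (forall i : 'I_n,
     \sum_c w c * exp_term (tnth (in_tuple (exp_cols mu ys)) c) (e0 + Posz i) = 0) ->
  forall c, w c = 0.
Proof.
move=> uys ys0 le_n w0 c; apply/eqP/negPn/negP => wc.
set cols := exp_cols mu ys in w w0 c wc le_n *.
set t := tnth (in_tuple cols) in w0 *.
have ut : injective t by apply/tuple_uniqP; apply: uniq_exp_cols.
have tP d : (t d).1 \in ys /\ ((t d).2 < mu (t d).1)%N.
  by apply/andP; rewrite -mem_exp_cols; apply: mem_tnth.
have [c0 wc0 max_c0] := @arg_maxnP _ c (fun d => w d != 0) (fun d => (t d).2) wc.
set y := (t c0).1 in max_c0; set l := (t c0).2 in max_c0.
have [yys lt_l] := tP c0.
pose g := \prod_(z <- ys | z != y) ('X - z%:P) ^+ mu z.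
pose f := ('X - y%:P) ^+ l * g.
have y_neq0 z : z \in ys -> z != 0 by apply: contraTneq => ->.
(* Since [l < mu y], the degree of [f] is below the number of columns. *)
have szf : (size f <= n)%N.
  apply: leq_trans le_n; rewrite size_exp_cols (bigD1_seq y) //=.
  have szg : (size g <= (\sum_(z <- ys | z != y) mu z).+1)%N.
    rewrite /g; elim/big_rec2: _ => [|z m u _ szu]; first by rewrite size_poly1.
    apply: leq_trans (size_polyMleq _ _) _.
    by rewrite size_exp_XsubC /= -addnS leq_add2l.
  apply: leq_trans (size_polyMleq _ _) _; rewrite size_exp_XsubC /=.
  by apply: leq_trans (leq_add (leqnn l) szg) _; rewrite addnS -addSn leq_add2r.
have f0 : f != 0.
  by apply/monic_neq0/rpredM; rewrite ?rpred_prod // => *; rewrite rpredX ?monicXsubC.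
have : \sum_(i < n) f`_i * (\sum_c w c * exp_term (t c) (e0 + Posz i)) = 0.
  by rewrite big1 // => i _; rewrite w0 mulr0.
under eq_bigr => i _ do rewrite mulr_sumr.
rewrite exchange_big /=.
under eq_bigr => d _ do (under eq_bigr => i _ do rewrite mulrCA; rewrite -mulr_sumr).
rewrite (bigD1 c0) //= [X in _ + X]big1 ?addr0 => [|d dc0].
  rewrite sum_exponential ?y_neq0 //.
  have [h] := iter_theta_XsubC e0%:~R y g l 0.
  rewrite add0n -/f -/y -/l => -> hy /eqP; apply/negP.
  have gy : g.[y] != 0.
    rewrite /g horner_prod prodf_seq_neq0; apply/allP => z _; apply/implyP => zy.
    by rewrite horner_exp hornerXsubC expf_neq0 // subr_eq0 eq_sym.
  have y0 : y != 0 by apply: y_neq0.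
  by rewrite expr0 mul1r !mulf_neq0 ?expfz_neq0 ?hy.
have [->|wd] := eqVneq (w d) 0; first by rewrite mul0r.
have [dys lt_ld] := tP d.
rewrite sum_exponential_root ?mulr0 ?y_neq0 //.
(* Another root has its full multiplicity in [g]; at [y] itself, maximality and injectivity of [t]
   force an exponent strictly below [l]. *)
have [dy|dy] := eqVneq (t d).1 y; last first.
  apply: leq_trans lt_ld _; rewrite mup_geq // dvdp_mull // /g.
  by rewrite -big_filter (bigD1_seq (t d).1) ?filter_uniq ?mem_filter ?dy //= dvdp_mulr.
have le_dl : ((t d).2 <= l)%N := max_c0 d wd.
have lt_dl : ((t d).2 < l)%N.
  rewrite ltn_neqAle le_dl andbT; apply: contra dc0 => /eqP dl.
  by apply/eqP/ut/eqP; rewrite -pair_eqE /pair_eq dl dy !eqxx.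
by apply: leq_trans lt_dl _; rewrite dy mup_geq // dvdp_mulr.
Qed.

End ExponentialPolynomials.

(** * Finite sums and the largest index of a support *)

Lemma sum_triangle (V : nmodType) n (F : nat -> nat -> V) :
  \sum_(0 <= e < n) \sum_(e.+1 <= l < n.+1) F e l =
  \sum_(1 <= l < n.+1) \sum_(0 <= e < l) F e l.
Proof.
elim: n => [|n IHn]; first by rewrite !big_geq.
rewrite [RHS]big_nat_recr //= -IHn.
under eq_big_nat => e en do rewrite big_nat_recr //=.
by rewrite big_split /= [X in X + _]big_nat_recr //= [X in _ + X + _]big_geq // addr0.
Qed.

Lemma sum_window (R : pzSemiRingType) lo hi n (F : nat -> R) : (hi <= n)%N ->
  \sum_(b < n) (lo <= b < hi)%N%:R * F b = \sum_(lo <= b < hi) F b.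
Proof.
move=> le_hi; rewrite -(big_mkord xpredT (fun b => (lo <= b < hi)%N%:R * F b)).
have [le_lo|lt_hi] := leqP hi lo.
  by rewrite [RHS]big_geq // big1 // => b _; rewrite (_ : _ && _ = false) ?mul0r //; lia.
rewrite (big_cat_nat _ (n := hi)) //= [X in _ + X]big_nat [X in _ + X]big1 ?addr0; last first.
  by move=> b bn; rewrite (_ : _ && _ = false) ?mul0r //; lia.
rewrite (big_cat_nat _ (n := lo)) //= ?(ltnW lt_hi) //.
rewrite [X in X + _]big_nat [X in X + _]big1 ?add0r; last first.
  by move=> b bn; rewrite (_ : _ && _ = false) ?mul0r //; lia.
by apply: eq_big_nat => b ->; rewrite mul1r.
Qed.

Lemma sum_point (R : pzSemiRingType) j n (F : nat -> R) : (j < n)%N ->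
  \sum_(b < n) (b == j :> nat)%:R * F b = F j.
Proof.
move=> ltj; rewrite (bigD1 (Ordinal ltj)) //= eqxx mul1r big1 ?addr0 // => b.
by rewrite -(inj_eq val_inj) /= => /negPf->; rewrite mul0r.
Qed.

Lemma max_support (C : numClosedFieldType) (k : nat) (f : nat -> C)
    (K := \max_(1 <= j < k.+1 | 0 < f j) j) :
  (forall l, (1 <= l <= k)%N -> 0 <= f l) -> 0 < \sum_(1 <= l < k.+1) f l ->
  [/\ (0 < K)%N, (K <= k)%N, 0 < f K & forall l, (K < l <= k)%N -> f l = 0].
Proof.
move=> f_ge0 f_sum.
have le_K l : (1 <= l <= k)%N -> 0 < f l -> (l <= K)%N.
  by move=> lk fl; apply: (@leq_bigmax_seq _ _ _ id); rewrite ?mem_index_iota.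
have f_top l : (K < l <= k)%N -> f l = 0.
  move=> /andP[Kl lk]; apply/eqP/negPn/negP => fl0.
  have lk1 : (1 <= l <= k)%N by lia.
  by have := le_K l lk1; rewrite lt0r fl0 f_ge0 // leqNgt Kl => /(_ isT).
have [K0|K_gt0] := posnP K.
  move: f_sum; rewrite big_nat big1 ?ltxx // => l lk.
  by apply: f_top; rewrite K0; lia.
(* An empty maximum is 0, so the induction has to carry that alternative. *)
have : (K == 0)%N || ((K <= k)%N && (0 < f K)).
  rewrite /K big_nat_cond; elim/big_ind: _ => // [x y|i /andP[/andP[_ ik] ->]].
    by rewrite /maxn; case: ifP.
  by rewrite -ltnS ik orbT.
by rewrite eqn0Ngt K_gt0 /= => /andP[].
Qed.

(** * Coefficients and nonzero roots of [psi] *)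

Section Chain.
Variables (C : numClosedFieldType) (k : nat) (p q : nat -> C).
Hypothesis p_ge0 : forall l, (1 <= l <= k)%N -> 0 <= p l.
Hypothesis q_ge0 : forall l, (1 <= l <= k)%N -> 0 <= q l.
Hypothesis pq_sum1 : \sum_(1 <= l < k.+1) (p l + q l) = 1.
Hypothesis p_sum : 0 < \sum_(1 <= l < k.+1) p l.
Hypothesis q_sum : 0 < \sum_(1 <= l < k.+1) q l.

Local Notation kp := (kp k p).
Local Notation kq := (kq k q).
Local Notation rr := (rr k p q).
Local Notation gamma := (gamma k p q).
Local Notation psi := (psi k p q).
Local Notation xi_prob := (xi_prob k p q).

Lemma kp_support : [/\ (0 < kp)%N, (kp <= k)%N, 0 < p kp &
  forall l, (kp < l <= k)%N -> p l = 0].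
Proof. exact: max_support. Qed.

Lemma kq_support : [/\ (0 < kq)%N, (kq <= k)%N, 0 < q kq &
  forall l, (kq < l <= k)%N -> q l = 0].
Proof. exact: max_support. Qed.

Lemma gamma_low j : (j < k - kp)%N -> gamma j = 0.
Proof.
have [_ kpk _ p0] := kp_support => ltj; rewrite /Defs.gamma.
have -> : (j < k)%N by lia.
by rewrite big_nat big1 ?oppr0 // => l lk; apply: p0; lia.
Qed.

Lemma gamma_high j : (k + kq <= j)%N -> gamma j = 0.
Proof.
have [_ kqk _ q0] := kq_support => ltj; rewrite /Defs.gamma.
have -> : (j < k)%N = false by lia.
by rewrite big_nat big1 // => l lk; apply: q0; lia.
Qed.

Lemma gamma_first : gamma (k - kp) != 0.
Proof.
have [kp0 kpk pkp p0] := kp_support; rewrite /Defs.gamma.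
have -> : (k - kp < k)%N by lia.
rewrite subKn // big_ltn ?ltnS // big_nat big1 ?addr0 ?oppr_eq0 ?gt_eqF //.
Qed.

Lemma gamma_last : gamma (k + kq).-1 != 0.
Proof.
have [kq0 kqk qkq q0] := kq_support; rewrite /Defs.gamma.
have -> : ((k + kq).-1 < k)%N = false by lia.
have -> : ((k + kq).-1 - k + 1 = kq)%N by lia.
rewrite big_ltn ?ltnS // big_nat big1 ?addr0 ?gt_eqF //.
Qed.

Lemma coef_psi j : psi`_j = gamma j.
Proof.
have [kq0 kqk _ _] := kq_support.
by rewrite coef_poly; case: ltnP => // ltj; rewrite gamma_high //; lia.
Qed.

Lemma size_psi : (size psi <= 2 * k)%N.
Proof. exact: size_poly. Qed.

(** The outermost nonzero coefficients have indices [k - kp] and [k + kq - 1], so [psi] is a power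
    of ['X] times a polynomial [phi] of degree [rr] with [phi.[0] != 0], which splits. *)
Lemma sum_mup_psi ys : uniq ys ->
  (forall y, y \in ys -> y != 0 /\ root psi y) ->
  (forall y, y != 0 -> root psi y -> y \in ys) ->
  (\sum_(y <- ys) mup y psi)%N = rr.
Proof.
move=> uys ys_root root_ys.
have [kp0 kpk _ _] := kp_support; have [kq0 kqk _ _] := kq_support.
pose phi := \poly_(j < rr.+1) gamma (j + (k - kp)).
have psiE : psi = 'X^(k - kp) * phi.
  apply/polyP => j; rewrite coef_psi coefXnM coef_poly.
  case: ltnP => [/gamma_low //|lej]; rewrite subnK //.
  by case: ltnP => // ltj; apply: gamma_high; move: ltj; rewrite /Defs.rr; lia.
have sz_phi : size phi = rr.+1.
  rewrite size_poly_eq // /Defs.rr.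
  by rewrite (_ : _ + _ = (k + kq).-1)%N ?gamma_last //; lia.
have phi0 : phi.[0] != 0.
  by rewrite horner_coef0 coef_poly /= add0n gamma_first.
have phi_neq0 : phi != 0 by rewrite -size_poly_eq0 sz_phi.
have [rs] := closed_field_poly_normal phi.
set c := lead_coef phi => phiE.
have c0 : c != 0 by rewrite lead_coef_eq0.
have sz_rs : size rs = rr.
  by move: sz_phi; rewrite phiE size_scale // size_prod_XsubC => -[].
have rs_ys y : y \in rs -> y \in ys.
  rewrite -root_prod_XsubC => rt.
  have rt_phi : root phi y by rewrite phiE rootZ.
  apply: root_ys; last by rewrite psiE rootM rt_phi orbT.
  by apply: contraTneq rt_phi => ->; rewrite /root (negPf phi0).
have mupE y : y \in ys -> mup y psi = count_mem y rs.
  move=> /ys_root[y0 _]; rewrite psiE mupMr; last first.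
    by rewrite /root hornerXn expf_eq0 (negPf y0) andbF.
  by rewrite phiE -mul_polyC mupMr ?mu_prod_XsubC // rootC.
rewrite big_seq (eq_bigr _ mupE) -big_seq -sz_rs.
have -> : size rs = \sum_(x <- rs) 1%N by rewrite sum1_size.
under eq_bigr => y _ do rewrite -sum1_count.
rewrite (exchange_big_dep predT) //= big_seq [RHS]big_seq; apply: eq_bigr => x xrs.
rewrite sum1_count (eq_count (a2 := pred1 x)) => [|y /=]; last exact: eq_sym.
by rewrite count_uniq_mem // rs_ys.
Qed.

(** * Step law, transition matrix and flow across edges *)

Lemma xi_probB (S S1 S2 : int -> bool) :
  (forall x, (S x)%:R = (S1 x)%:R - (S2 x)%:R :> C) ->
  xi_prob S = xi_prob S1 - xi_prob S2.
Proof.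
move=> SE; rewrite /Defs.xi_prob -sumrB; apply: eq_bigr => l _.
by rewrite !SE; ring.
Qed.

Lemma xi_probT : xi_prob xpredT = 1.
Proof. by rewrite -pq_sum1; apply: eq_bigr => l _; rewrite !mul1r. Qed.

Lemma xi_prob_ge0 S : 0 <= xi_prob S.
Proof.
rewrite /Defs.xi_prob big_nat; apply: sumr_ge0 => l lk.
by rewrite addr_ge0 // mulr_ge0 ?ler0n ?p_ge0 ?q_ge0.
Qed.

Lemma xi_prob_gt0 (S : int -> bool) l :
  (1 <= l <= k)%N -> 0 < q l -> S (- Posz l) -> 0 < xi_prob S.
Proof.
move=> lk ql Sl; rewrite /Defs.xi_prob (bigD1_seq l) ?mem_index_iota ?iota_uniq //=.
rewrite Sl mul1r ltr_pwDl //; last first.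
  rewrite big_nat_cond sumr_ge0 // => j /andP[jk _].
  by rewrite addr_ge0 // mulr_ge0 ?ler0n ?p_ge0 ?q_ge0.
by rewrite ltr_wpDl // mulr_ge0 ?ler0n ?p_ge0.
Qed.

Variable N : nat.
Hypothesis N_gt0 : (0 < N)%N.

(** The probability of moving from [i] to a site at least [m]. For [0 < m <= N] reflection does not
    change this event, so the free step decides it. *)
Definition tail (i m : nat) : C :=
  if m == 0%N then 1
  else if (m <= N)%N then xi_prob (fun x => Posz m <= Posz i + x) else 0.

(** Net downward flow across the edge between [m - 1] and [m] per unit of mass at [i]. The guard
    keeps truncated subtraction from returning [gamma 0] when [i] is too far below. *)
Definition cut_coef (m i : nat) : C :=
  if (m <= i + k)%N then gamma (i + k - m) else 0.

Lemma leap_P_tail (i j : 'I_N.+1) : leap_P k p q N i j = tail i j - tail i j.+1.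
Proof.
rewrite mxE /tail /=; have [j0|j0] := eqVneq (j : nat) 0%N.
  rewrite j0 N_gt0 -xi_probT; apply: xi_probB => x.
  have -> : (Posz i + x <= 0) = ~~ (1%Z <= Posz i + x) by lia.
  by case: (_ <= _); rewrite /= ?subrr ?subr0.
have -> : (j <= N)%N by rewrite -ltnS.
have [jN|jN] := eqVneq (j : nat) N; first by rewrite jN ltnn subr0.
have -> : (j < N)%N by have := ltn_ord j; lia.
apply: xi_probB => x; set y := Posz i + x.
have -> : (y == j) = (Posz j <= y) && ~~ (Posz j.+1 <= y) by lia.
have : (Posz j.+1 <= y) -> (Posz j <= y) by lia.
by case: (Posz j.+1 <= y) => [->|_] /=; rewrite ?subrr ?andbT ?subr0.
Qed.

Lemma leap_P_ge0 i j : 0 <= leap_P k p q N i j.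
Proof. by rewrite mxE; do 2?case: ifP => _; apply: xi_prob_ge0. Qed.

Lemma leap_P_sum1 i : \sum_j leap_P k p q N i j = 1.
Proof.
under eq_bigr => j _ do rewrite leap_P_tail -opprB.
rewrite sumrN -(big_mkord xpredT (fun j => tail i j.+1 - tail i j)).
by rewrite telescope_sumr // /tail /= ltnn sub0r opprK.
Qed.

Lemma leap_P_down (i : 'I_N.+1) : (0 < i)%N ->
  exists2 j : 'I_N.+1, (j < i)%N & 0 < leap_P k p q N i j.
Proof.
move=> i_gt0; have [kq0 kqk qkq _] := kq_support.
(* Truncated subtraction matches the reflection at 0 of the step [- kq]. *)
have lt_j : (i - kq < N.+1)%N by rewrite (leq_ltn_trans (leq_subr _ _)).
exists (Ordinal lt_j) => /=; first by lia.
have lt_iN := ltn_ord i.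
rewrite mxE /=; case: eqP => [j0|j0].
  by apply: (@xi_prob_gt0 _ kq) => //; lia.
case: eqP => [jN|_]; first by lia.
by apply: (@xi_prob_gt0 _ kq) => //; lia.
Qed.

(* Only the steps that cross the level [m] contribute to the flow balance. *)
Lemma tail_cut (i m : nat) : (0 < m <= N)%N ->
  tail i m - (m <= i)%:R = - cut_coef m i.
Proof.
case/andP=> m0 mN; rewrite /tail /cut_coef (gtn_eqF m0) mN /Defs.gamma.
have [le_mi|lt_im] := leqP m i.
  have -> : (m <= i + k)%N by lia.
  have -> : (i + k - m < k)%N = false by lia.
  (* From a site above the cut, one minus the upper tail is the probability of landing below [m], a
     tail of [q]. *)
  apply: oppr_inj; rewrite opprB opprK -xi_probT.
  rewrite -(@xi_probB (fun x => Posz i + x < Posz m)) => [|x]; last first.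
    by rewrite ltNge; case: (_ <= _); rewrite /= ?subrr ?subr0.
  rewrite [RHS](@big_nat_widenl _ _ _ _ 1) /=; last by lia.
  rewrite [RHS]big_mkcond /= /Defs.xi_prob; apply: eq_big_nat => l lk.
  have -> : (Posz i + Posz l < Posz m) = false by lia.
  have -> : (Posz i - Posz l < Posz m) = (i + k - m - k + 1 <= l)%N by lia.
  by case: ifP => _; rewrite ?mul0r ?mul1r add0r.
rewrite subr0.
transitivity (\sum_(1 <= l < k.+1) if (m - i <= l)%N then p l else 0).
  apply: eq_big_nat => l lk.
  have -> : (Posz m <= Posz i - Posz l) = false by lia.
  have -> : (Posz m <= Posz i + Posz l) = (m - i <= l)%N by lia.
  by case: ifP => _; rewrite ?mul0r ?mul1r addr0.
case: (leqP m (i + k)) => [le_m|lt_m].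
  have -> : (i + k - m < k)%N by lia.
  have -> : (k - (i + k - m) = m - i)%N by lia.
  by rewrite opprK -big_mkcond [RHS](@big_nat_widenl _ _ _ _ 1) //; lia.
rewrite oppr0 big_nat big1 // => l lk.
by have -> : (m - i <= l)%N = false by lia.
Qed.

(** Balance across the edge below [m] says that one step preserves the mass on sites at least [m];
    differences of consecutive masses give each entry. *)
Lemma cut_invariant (v : 'rV[C]_N.+1) :
  (forall m, (0 < m <= N)%N -> \sum_(i < N.+1) v 0 i * cut_coef m i = 0) ->
  v *m leap_P k p q N = v.
Proof.
move=> v_cut.
have v_tail m : (m <= N.+1)%N ->
    \sum_(i < N.+1) v 0 i * tail i m = \sum_(i < N.+1) v 0 i * (m <= i)%:R.
  move=> mN; apply/eqP; rewrite -subr_eq0 -sumrB; apply/eqP.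
  under eq_bigr => i _ do rewrite -mulrBr.
  have [m0|m0] := posnP m.
    by apply: big1 => i _; rewrite m0 /tail subrr mulr0.
  have [lt_mN|le_Nm] := leqP m N.
    under eq_bigr => i _ do rewrite tail_cut ?m0 // mulrN.
    by rewrite sumrN v_cut ?m0 // oppr0.
  apply: big1 => i _; rewrite /tail (gtn_eqF m0) leqNgt le_Nm /= leqNgt.
  by rewrite (leq_trans (ltn_ord i)) // subrr mulr0.
apply/rowP => j; rewrite mxE.
under eq_bigr => i _ do rewrite leap_P_tail mulrBr.
rewrite sumrB !v_tail //; last exact: ltnW.
rewrite -sumrB (bigD1 j) //= leqnn ltnn mulr1 mulr0 subr0 big1 ?addr0 // => i ij.
have -> : (j <= i)%N = (j < i)%N by move: ij; rewrite -(inj_eq val_inj) /=; lia.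
by rewrite subrr.
Qed.

(** * Combinations of the columns of [Ymx] as sequences on the integers *)

Variable ys : seq C.
Local Notation Ycols := (Ycols k p q ys).
Local Notation Y := (Ymx k p q N ys).
Local Notation P := (leap_P k p q N).

Hypothesis uniq_ys : uniq ys.
Hypothesis ys_root : forall y, y \in ys -> y != 0 /\ root psi y.
Hypothesis root_ys : forall y, y != 0 -> root psi y -> y \in ys.

Let kp_gt0 : (0 < kp)%N. Proof. by case: kp_support. Qed.
Let kp_le : (kp <= k)%N. Proof. by case: kp_support. Qed.
Let p_top l : (kp < l <= k)%N -> p l = 0.
Proof. by case: kp_support => _ _ _; apply. Qed.
Let kq_gt0 : (0 < kq)%N. Proof. by case: kq_support. Qed.
Let kq_le : (kq <= k)%N. Proof. by case: kq_support. Qed.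
Let q_top l : (kq < l <= k)%N -> q l = 0.
Proof. by case: kq_support => _ _ _; apply. Qed.
Let rrE : rr = (kp + kq).-1. Proof. by []. Qed.

Lemma size_Ycols : size Ycols = rr.
Proof. by rewrite -(sum_mup_psi uniq_ys) // -size_exp_cols. Qed.

Lemma mem_Ycols yl : yl \in Ycols -> yl.1 != 0 /\ (yl.2 < mup yl.1 psi)%N.
Proof.
rewrite -[Ycols]/(exp_cols (fun y => mup y psi) ys) mem_exp_cols.
by move=> /andP[/ys_root[]].
Qed.

Definition xseq (c : 'cV[C]_rr) (e : int) : C :=
  \sum_(a < rr) c a 0 * exp_term (nth (0, 0%N) Ycols a) e.

Lemma Ymx_xseq c b : (Y *m c) b 0 = xseq c (Posz b.+2 - Posz kp).
Proof. by rewrite mxE; apply: eq_bigr => a _; rewrite mxE mulrC. Qed.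

Lemma xseq_rec c (e : int) : \sum_(j < (2 * k)%N) gamma j * xseq c (e + Posz j) = 0.
Proof.
under eq_bigr => j _ do rewrite mulr_sumr.
rewrite exchange_big big1 //= => a _.
under eq_bigr => j _ do rewrite mulrCA.
rewrite -mulr_sumr.
have /mem_Ycols[y0 lt_l] : nth (0, 0%N) Ycols a \in Ycols.
  by rewrite mem_nth // size_Ycols.
under eq_bigr => j _ do rewrite -coef_psi.
by rewrite sum_exponential_root ?mulr0 // size_psi.
Qed.

(** The rows of [Ymx] cover [N + rr - 1 >= rr] consecutive integers, enough for the confluent
    Vandermonde argument. *)
Lemma xseq_inj (c : 'cV[C]_rr) :
  (forall b, (b < (N + rr).-1)%N -> xseq c (Posz b.+2 - Posz kp) = 0) -> c = 0.
Proof.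
move=> c0; have ERR : size Ycols = rr := size_Ycols.
pose w (d : 'I_(size Ycols)) := c (cast_ord ERR d) 0.
have w0 : forall d, w d = 0.
  apply: (@exp_cols_free _ (fun y => mup y psi) ys (2%:Z - Posz kp) (N + rr).-1) => //.
  - by apply/negP => /ys_root[]; rewrite eqxx.
  - by rewrite -[exp_cols _ _]/Ycols size_Ycols; lia.
  move=> b; rewrite -[RHS](c0 b) //.
  rewrite (_ : 2%:Z - Posz kp + Posz b = Posz b.+2 - Posz kp); last by lia.
  rewrite /xseq (reindex (cast_ord ERR)) /=; last first.
    by exists (cast_ord (esym ERR)) => d _; rewrite ?cast_ordK ?cast_ordKV.
  by apply: eq_bigr => d _; rewrite (tnth_nth (0, 0%N)).
apply/colP => a; rewrite mxE -(w0 (cast_ord (esym ERR) a)) /w.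
by rewrite cast_ordKV.
Qed.

(* [level t c (k + i)] is the candidate mass at the site [i], extended to all
   sites [i >= -k]: its increments are the values of the sequence [xseq c] and
   its value at the site [0] is [-t]. *)
Definition incr (c : 'cV[C]_rr) (n : nat) : C := xseq c (Posz n - Posz k).

Definition level (t : C) (c : 'cV[C]_rr) (n : nat) : C :=
  - t - \sum_(0 <= i < k) incr c i.+1 + \sum_(0 <= i < n) incr c i.+1.

Lemma levelS t c n : level t c n.+1 = level t c n + incr c n.+1.
Proof. by rewrite /level big_nat_recr //= addrA. Qed.

Lemma level_add t c i :
  level t c (k + i) = - t + \sum_(0 <= e < i) incr c (k + e).+1.
Proof.
elim: i => [|i IHi]; first by rewrite addn0 /level subrK big_geq ?addr0.
by rewrite addnS levelS IHi big_nat_recr //= addrA.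
Qed.

Lemma level_site0 t c : level t c k = - t.
Proof. by rewrite /level subrK. Qed.

(** * The row-reduced family [Mmx] and its action on a vector *)

Definition Erow : 'M[C]_rr :=
  \matrix_(a, b) ((a == b) || ((a == kp :> nat) && (b == kp.-1 :> nat)))%:R.

Definition Mmx (i : nat) : 'M[C]_(rr + 1) :=
  block_mx Erow 0 0 1%:M *m Wmx k p q N ys i.

Lemma det_Mmx i : \det (Mmx i) = \det (Wmx k p q N ys i).
Proof.
rewrite det_mulmx det_ublock det1 mulr1 det_trig ?big1 ?mul1r // => [a _|].
  by rewrite mxE eqxx.
apply/is_trig_mxP => a b ab; rewrite mxE (_ : _ || _ = false) //.
by rewrite -(inj_eq val_inj) /=; lia.
Qed.

Definition pivot : 'I_rr.
Proof. by apply: (@Ordinal _ kp.-1); rewrite rrE; lia. Defined.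

(** Windows of ones telescope: row [kp - 1] sums the first [i] increments and [evec] supplies [- t].
    Adding it to row [kp] completes the window from [i] to [N] to a sum free of [i]; if [kq = 1]
    there is no row [kp] and [Erow] is the identity. *)
Lemma Mmx_mul i (w : 'cV[C]_(rr + 1)) (c := usubmx w) (t := dsubmx w 0 0) :
  (i <= N)%N ->
  (forall a : 'I_rr, (Mmx i *m w) (lshift 1 a) 0 =
     if (a < kp.-1)%N then incr c (k + a.+2 - kp) + (a == kp.-2 :> nat)%:R * t
     else if a == kp.-1 :> nat then level t c (k + i)
     else if a == kp :> nat then level t c (k + N.+1)
     else incr c (k + a + N.+1 - kp)) /\
  (forall a : 'I_1, (Mmx i *m w) (rshift rr a) 0 =
     (\sum_(0 <= e < kq) (\sum_(e.+1 <= l < kq.+1) (l - e)%:R * q l) *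
       incr c (k + e).+1) + Wcorner k p q * t).
Proof.
move=> iN; pose x := Y *m c.
have xE b : x b 0 = incr c (k + b.+2 - kp).
  by rewrite /x Ymx_xseq /incr; congr xseq; lia.
pose z := Adag k p q N i *m x + evec k p q *m dsubmx w.
have MwE : Mmx i *m w = col_mx (Erow *m z)
    (Defs.eta k p q N *m x + (Wcorner k p q)%:M *m dsubmx w).
  rewrite /Mmx /Wmx -[in LHS](vsubmxK w) -mulmxA mul_block_col mul_block_col.
  by rewrite !mul0mx addr0 add0r mul1mx /z /x !mulmxA.
have zE (a : 'I_rr) : z a 0 =
     if (a < kp.-1)%N then incr c (k + a.+2 - kp) + (a == kp.-2 :> nat)%:R * t
     else if a == kp.-1 :> nat then level t c (k + i)
     else if a == kp :> nat then \sum_(i <= e < N.+1) incr c (k + e).+1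
     else incr c (k + a + N.+1 - kp).
  pose F b := incr c (k + b.+2 - kp).
  have -> : z a 0 = \sum_(b < (N + rr).-1) Adag k p q N i a b * F b +
      (((1 < kp)%N && (a == kp.-2 :> nat))%:R - (a == kp.-1 :> nat)%:R) * t.
    rewrite mxE [X in X + _]mxE [X in _ + X]mxE big_ord1 mxE; congr (_ + _).
    by apply: eq_bigr => b _; rewrite xE.
  have shift lo hi : (lo + kp.-1 <= hi)%N ->
      \sum_(lo + kp.-1 <= b < hi) F b =
      \sum_(lo <= e < hi - kp.-1) incr c (k + e).+1.
    move=> lohi; rewrite big_addn; apply: eq_big_nat => e _; rewrite /F.
    by congr incr; lia.
  have lt_a := ltn_ord a.
  under eq_bigr => b _ do rewrite mxE.
  case: ifP => [lt_akp|ge_akp].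
    rewrite sum_point; last by lia.
    have -> : (1 < kp)%N by lia.
    have -> : (a == kp.-1 :> nat) = false by lia.
    by rewrite subr0.
  have -> : (1 < kp)%N && (a == kp.-2 :> nat) = false by lia.
  case: eqP => [a_kp|a_kp].
    rewrite sum_window; last by lia.
    rewrite -[X in \sum_(X <= _ < _) _]add0n shift ?level_add; last by lia.
    by rewrite (_ : _ - _ = i)%N ?sub0r ?mulN1r 1?addrC //; lia.
  rewrite subr0 mul0r addr0; case: eqP => [a_kp'|a_kp'].
    rewrite sum_window; last by lia.
    rewrite [X in \sum_(X <= _ < _) _]addnC shift; last by lia.
    by rewrite (_ : _ - _ = N.+1)%N //; lia.
  rewrite sum_point; last by lia.
  by rewrite /F; congr incr; lia.
split=> a.
  have Ez : (Erow *m z) a 0 = z a 0 + (a == kp :> nat)%:R * z pivot 0.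
    rewrite mxE; have [a_kp|a_kp] := eqVneq (a : nat) kp.
      rewrite (bigD1 a) //= (bigD1 pivot) /=; last first.
        by rewrite -(inj_eq val_inj) /= a_kp; lia.
      rewrite [Erow a a]mxE [Erow a pivot]mxE a_kp !eqxx orbT !mul1r.
      rewrite [X in _ + (_ + X)]big1 ?addr0 // => b /andP[ba b0].
      rewrite mxE eq_sym (negPf ba) a_kp /=.
      by rewrite -(inj_eq val_inj) /= in b0; rewrite (negPf b0) andbF mul0r.
    rewrite mul0r addr0 (bigD1 a) //= [Erow a a]mxE eqxx mul1r.
    rewrite [X in _ + X]big1 ?addr0 // => b ba.
    by rewrite mxE eq_sym (negPf ba) (negPf a_kp) mul0r.
  rewrite MwE col_mxEu Ez !zE /= ltnn eqxx.
  have [a_kp|a_kp] := eqVneq (a : nat) kp; last by rewrite mul0r addr0.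
  have -> : (a < kp.-1)%N = false by lia.
  have -> : (a == kp.-1 :> nat) = false by lia.
  rewrite mul1r addrC !level_add -addrA; congr (_ + _).
  by rewrite -big_cat_nat //=; apply: leqW.
rewrite MwE col_mxEd mxE (ord1 a); congr (_ + _); last first.
  by rewrite mxE big_ord1 mxE eqxx mulr1n.
rewrite mxE.
pose G b := (\sum_(b.+1 - kp + 1 <= l < kq.+1) (l + kp - b.+1)%:R * q l) *
  incr c (k + b.+2 - kp).
transitivity (\sum_(b < (N + rr).-1) (kp.-1 <= b < rr)%N%:R * G b).
  apply: eq_bigr => b _; rewrite xE mxE /=.
  have -> : (kp <= b.+1 <= rr)%N = (kp.-1 <= b < rr)%N by lia.
  by case: ifP => _; rewrite ?mul1r ?mul0r.
rewrite sum_window; last by lia.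
(* With [b = e + kp - 1], the entries of [eta] become weights of the increments to the right of site
   0. *)
rewrite -[X in \sum_(X <= _ < _) _]add0n big_addn (_ : rr - _ = kq)%N; last by lia.
apply: eq_big_nat => e _; rewrite /G; congr (_ * incr _ _); last by lia.
rewrite (_ : _ - _ + 1 = e.+1)%N; last by lia.
by apply: eq_bigr => l _; congr (_%:R * _); lia.
Qed.

Definition pivot_row : 'I_(rr + 1) := lshift 1 pivot.

Lemma Mmx_agree a : a != pivot_row -> forall (i j : 'I_N.+1) b, Mmx i a b = Mmx j a b.
Proof.
move=> ai0 i j b.
(* Entries are products with unit vectors, so [Mmx_mul] describes them. *)
have entryE (A : 'M[C]_(rr + 1)) : A a b = (A *m (delta_mx b 0 : 'cV_(rr + 1))) a 0.
  by rewrite -colE mxE.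
rewrite !entryE; set w : 'cV_(rr + 1) := delta_mx b 0.
have [ui di] := @Mmx_mul i w (ltn_ord i).
have [uj dj] := @Mmx_mul j w (ltn_ord j).
case: (splitP a) ai0 => a' aE ai0.
  have {aE} aE : a = lshift 1 a' by apply: val_inj.
  rewrite aE ui uj; case: ifP => // _; case: eqP => // a'0.
  by case/eqP: ai0; rewrite aE; congr lshift; apply: val_inj.
have -> : a = rshift rr a' by apply: val_inj.
by rewrite di dj.
Qed.

(** * Vectors annihilated by all rows except the pivot row *)

Section Solution.
Variable w : 'cV[C]_(rr + 1).
Hypothesis w_sol : forall (i : 'I_N.+1) a, a != pivot_row -> (Mmx i *m w) a 0 = 0.

Let c := usubmx w.
Let t := dsubmx w 0 0.

Lemma level_low d : (0 < d < kp)%N -> level t c (k - d) = 0.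
Proof.
have row_low (a : nat) : (a < kp.-1)%N ->
    incr c (k + a.+2 - kp) + (a == kp.-2)%:R * t = 0.
  move=> lta; have ltr : (a < rr)%N by rewrite rrE; lia.
  have [u _] := @Mmx_mul 0 w isT; have := u (Ordinal ltr); rewrite /= lta => <-.
  by apply: (w_sol 0); rewrite (inj_eq (@lshift_inj _ _)) -(inj_eq val_inj) /=; lia.
elim: d => // d IHd /andP[_ lt_d].
have : level t c (k - d) = level t c (k - d.+1) + incr c (k - d).
  by rewrite (_ : k - d = (k - d.+1).+1)%N ?levelS //; lia.
(* Row [kp - 2 - d] reads the increment into site [- d]: it is [- t], the level itself, for [d = 0],
   and zero further left. *)
have lt_row : (kp.-2 - d < kp.-1)%N by lia.
have := row_low _ lt_row; rewrite (_ : (_ - kp = k - d)%N); last by lia.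
have [-> | d_gt0] := posnP d.
  rewrite !subn0 eqxx mul1r level_site0 => /eqP; rewrite addr_eq0 => /eqP-> /eqP.
  by rewrite -[X in X == _]add0r (inj_eq (addIr _)) => /eqP.
have -> : (kp.-2 - d == kp.-2)%N = false by lia.
rewrite mul0r addr0 => ->; rewrite addr0 => <-.
by apply: IHd; lia.
Qed.

Lemma level_high d : (0 < d < kq)%N -> level t c (k + N + d) = 0.
Proof.
have [u _] := @Mmx_mul 0 w isT.
have w_row (a : 'I_rr) : (a : nat) != kp.-1 -> (Mmx 0 *m w) (lshift 1 a) 0 = 0.
  by move=> a0; apply: (w_sol 0); rewrite (inj_eq (@lshift_inj _ _)) -(inj_eq val_inj).
elim: d => // d IHd /andP[_ lt_d].
have lta : (kp + d < rr)%N by rewrite rrE; lia.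
have := w_row (Ordinal lta); rewrite u /=.
rewrite (_ : (_ < kp.-1)%N = false); last by lia.
rewrite (_ : (_ == kp.-1)%N = false); last by lia.
case: (posnP d) => [->|d0]; first by rewrite addn0 eqxx addn1 -addnS; apply; lia.
rewrite (_ : (_ == kp)%N = false); last by lia.
rewrite [(k + N + d.+1)%N]addnS levelS (_ : _ - kp = (k + N + d).+1)%N; last by lia.
by move=> ->; rewrite ?IHd ?addr0 //; lia.
Qed.

(** Of the sites up to 0 where [gamma] is nonzero only site 0 has mass, giving the [p] part of
    [Wcorner]; summation by parts on the right gives [eta] and the [q] part. The total is the last
    row of [Mmx i *m w]. *)
Lemma balance_first : \sum_(0 <= j < 2 * k) gamma j * level t c j.+1 = 0.
Proof.
rewrite (big_cat_nat _ (n := k)) //=; last by lia.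
have -> : \sum_(0 <= j < k) gamma j * level t c j.+1 =
    (\sum_(1 <= l < kp.+1) p l) * t.
  have k_gt0 : (0 < k)%N := leq_trans kp_gt0 kp_le.
  rewrite -[in LHS](prednK k_gt0) big_nat_recr //= (prednK k_gt0) big_nat big1 ?add0r.
    rewrite level_site0 /Defs.gamma.
    rewrite ltn_predL k_gt0 mulrNN (_ : k - k.-1 = 1)%N; last by lia.
    congr (_ * _); rewrite (big_cat_nat _ (n := kp.+1)) //= [X in _ + X]big_nat.
    by rewrite [X in _ + X]big1 ?addr0 // => l lk; apply: p_top; lia.
  move=> j jk; have [ltj|lej] := ltnP j (k - kp); first by rewrite gamma_low ?mul0r.
  by rewrite (_ : j.+1 = k - (k - j.+1))%N ?level_low ?mulr0 //; lia.
have -> : \sum_(k <= j < 2 * k) gamma j * level t c j.+1 =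
    \sum_(0 <= i < k) \sum_(i.+1 <= l < k.+1) q l * level t c (k + i).+1.
  rewrite -[X in \sum_(X <= _ < _) _]add0n big_addn (_ : _ - k = k)%N; last by lia.
  apply: eq_big_nat => i ik; rewrite -mulr_suml [(i + k)%N]addnC; congr (_ * _).
  rewrite /Defs.gamma (_ : (_ < k)%N = false); last by lia.
  by rewrite (_ : _ - k + 1 = i.+1)%N //; lia.
rewrite sum_triangle.
(* The increment from site [e] to [e + 1] is counted by the [l - e] sites from [e + 1] to [l]. *)
have sum_level l : \sum_(0 <= i < l) level t c (k + i).+1 =
    - (l%:R * t) + \sum_(0 <= e < l) (l - e)%:R * incr c (k + e).+1.
  elim: l => [|l IHl]; first by rewrite !big_geq // mul0r oppr0 addr0.
  rewrite big_nat_recr //= IHl -addnS level_add.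
  have -> : \sum_(0 <= e < l.+1) (l.+1 - e)%:R * incr c (k + e).+1 =
      \sum_(0 <= e < l) (l - e)%:R * incr c (k + e).+1 +
      \sum_(0 <= e < l.+1) incr c (k + e).+1.
    rewrite !big_nat_recr //= addrA -big_split /= subSnn mul1r; congr (_ + _).
    by apply: eq_big_nat => e el; rewrite subSn -?natr1 ?mulrDl ?mul1r //; lia.
  by rewrite -natr1; ring.
have := Mmx_mul w (leq0n N) => -[_ /(_ 0)].
rewrite (w_sol 0) -/c -/t; last first.
  by rewrite -(inj_eq val_inj) /= rrE; lia.
under eq_bigr => e _ do rewrite mulr_suml.
rewrite sum_triangle /Wcorner => eta0.
rewrite [X in _ + X](big_cat_nat _ (n := kq.+1)) //= [X in _ + (_ + X)]big_nat.
rewrite [X in _ + (_ + X)]big1 ?addr0 => [|l lk]; last first.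
  by rewrite -mulr_sumr q_top ?mul0r //; lia.
rewrite [RHS]eta0 mulrBl [RHS]addrCA; congr (_ + _); rewrite mulr_suml -sumrB.
apply: eq_big_nat => l _; rewrite -mulr_sumr sum_level mulrDr addrC mulr_sumr.
by congr (_ + _); [apply: eq_bigr => e _|]; ring.
Qed.

(** The balances at two consecutive edges differ by the recurrence applied to the increments. *)
Lemma balance m : \sum_(0 <= j < 2 * k) gamma j * level t c (m.+1 + j) = 0.
Proof.
elim: m => [|m IHm]; first exact: balance_first.
rewrite -[RHS]IHm; apply/eqP; rewrite -subr_eq0 -sumrB; apply/eqP.
rewrite -[RHS](xseq_rec c (Posz m.+2 - Posz k)) big_mkord; apply: eq_bigr => j _.
rewrite addSn levelS mulrDr addrC addKr /incr; congr (_ * xseq _ _); lia.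
Qed.

Lemma level_invariant :
  (\row_(i < N.+1) level t c (k + i)) *m P = \row_(i < N.+1) level t c (k + i).
Proof.
apply: cut_invariant => m /andP[m0 mN].
pose G n := if (m <= n)%N then gamma (n - m) * level t c n else 0.
(* Outside the sites 0 to [N] either the coefficient or the level vanishes, so the cut sum equals
   the full recurrence sum. *)
have G_low n : (n < k)%N -> G n = 0.
  rewrite /G => nk; case: leqP => // mn.
  have [lt_n|le_n] := ltnP (n - m) (k - kp); first by rewrite gamma_low ?mul0r.
  by rewrite (_ : n = k - (k - n))%N ?level_low ?mulr0 //; lia.
have G_high n : (k + N < n)%N -> G n = 0.
  rewrite /G => nk; case: leqP => // mn.
  have [le_n|lt_n] := leqP (k + kq) (n - m); first by rewrite gamma_high ?mul0r.
  by rewrite (_ : n = k + N + (n - (k + N)))%N ?level_high ?mulr0 //; lia.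
transitivity (\sum_(0 <= n < N + 2 * k + m) G n).
  rewrite (big_cat_nat _ (n := k)) //=; last by lia.
  rewrite [X in _ = X + _]big_nat [X in _ = X + _]big1 ?add0r => [|n nk]; last exact: G_low.
  rewrite (big_cat_nat _ (n := (N.+1 + k)%N)) //=; try lia.
  rewrite [X in _ + X]big_nat [X in _ + X]big1 ?addr0 => [|n nk]; last first.
    by apply: G_high; lia.
  rewrite -[X in \sum_(X <= _ < _) _]add0n big_addn addnK big_mkord; apply: eq_bigr => i _.
  rewrite mxE /cut_coef /G; case: ifP => _; rewrite ?mulr0 //.
  by rewrite mulrC [(k + i)%N]addnC.
rewrite (big_cat_nat _ (n := m)) //=; last by lia.
rewrite big_nat big1 ?add0r => [|n nm]; last by rewrite /G (_ : (m <= n)%N = false) //; lia.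
rewrite (big_cat_nat _ (n := (2 * k + m)%N)) //=; try lia.
rewrite [X in _ + X]big_nat [X in _ + X]big1 ?addr0 => [|n nk]; last first.
  by rewrite /G gamma_high ?mul0r ?if_same //; lia.
rewrite -[X in \sum_(X <= _ < _) _]add0n big_addn addnK -[RHS](balance m.-1).
apply: eq_big_nat => j _; rewrite /G leq_addl addnK prednK // addnC //.
Qed.

Lemma solution_eq0 : \sum_(i < N.+1) (Mmx i *m w) pivot_row 0 = 0 -> w = 0.
Proof.
move=> sum0.
have v0 : (\row_(i < N.+1) level t c (k + i)) = 0.
  apply: (invariant_sum_eq0 (P := P)); [exact: leap_P_ge0 | exact: leap_P_sum1 |
    exact: leap_P_down | exact: level_invariant |].
  rewrite -[RHS]sum0; apply: eq_bigr => i _; rewrite mxE.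
  by have [-> _] := Mmx_mul w (ltn_ord i : (i <= N)%N); rewrite /= ltnn eqxx.
have lev0 i : (i <= N)%N -> level t c (k + i) = 0.
  by move=> iN; have /rowP/(_ (Ordinal (iN : (i < N.+1)%N))) := v0; rewrite !mxE.
have t0 : t = 0.
  by apply/eqP; rewrite -oppr_eq0 -(level_site0 t c) -[X in level _ _ X]addn0 lev0.
(* This window has [N + rr] sites, so its [N + rr - 1] increments are exactly the entries of
   [Y *m c]. *)
have lev0' n : (k - kp < n < k + N + kq)%N -> level t c n = 0.
  move=> nk; have [lt_nk|le_kn] := ltnP n k.
    by rewrite (_ : n = k - (k - n))%N ?level_low //; lia.
  have [le_nN|lt_Nn] := leqP n (k + N).
    by rewrite (_ : n = k + (n - k))%N ?lev0 //; lia.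
  by rewrite (_ : n = k + N + (n - (k + N)))%N ?level_high //; lia.
have c0 : c = 0.
  apply: xseq_inj => b ltb; have := levelS t c (k + b.+1 - kp).
  rewrite !lev0'; try by (rewrite rrE in ltb; lia).
  by rewrite add0r => /esym; rewrite /incr => <-; congr xseq; lia.
have d0 : dsubmx w = 0 by apply/colP => a; rewrite (ord1 a) [RHS]mxE.
by rewrite -[w]vsubmxK -/c c0 d0 col_mx0.
Qed.

End Solution.

(** * Determinant quotients as the stationary distribution *)

Lemma det_Wmx_stationary (W := Wmx k p q N ys)
    (S := \sum_(j < N.+1) \det (W j)) :
  S != 0 /\
  (forall pi : 'rV[C]_(N.+1),
     stationary k p q pi <-> (forall i : 'I_(N.+1), pi 0 i = \det (W i) / S)).
Proof.
have [v v_sol v_det] := family_cofactor Mmx_agree.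
have S_neq0 : S != 0.
  rewrite /S; under eq_bigr => j _ do rewrite -det_Mmx.
  by apply: (family_det_sum_neq0 Mmx_agree) => w w_sol; apply: solution_eq0.
pose mu : 'rV[C]_N.+1 := \row_i (\det (W i) / S).
have muP : mu *m P = mu.
  have muE : mu = S^-1 *: \row_(i < N.+1) \det (W i).
    by apply/rowP => i; rewrite !mxE mulrC.
  rewrite muE -scalemxAl; congr (_ *: _).
  (* Cofactor expansion along the pivot row turns the determinants into levels of [v]. *)
  suff -> : \row_(i < N.+1) \det (W i) =
      \row_(i < N.+1) level (dsubmx v 0 0) (usubmx v) (k + i).
    exact: level_invariant.
  apply/rowP => i; rewrite [LHS]mxE [RHS]mxE /W -det_Mmx -v_det.
  have [-> _] := Mmx_mul v (ltn_ord i : (i <= N)%N).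
  by rewrite /= ltnn eqxx.
have mu_sum : \sum_i mu 0 i = 1.
  by under eq_bigr => i _ do rewrite mxE; rewrite -mulr_suml divff.
split=> // pi; split=> [[_ [pi_sum piP]] i|piE].
  (* Two invariant vectors of mass one differ by an invariant vector of mass zero. *)
  have /rowP/(_ i) : pi - mu = 0.
    apply: (invariant_sum_eq0 leap_P_ge0 leap_P_sum1 leap_P_down).
      by rewrite mulmxBl piP muP.
    under eq_bigr => j _ do rewrite mxE [(- mu) _ _]mxE.
    by rewrite sumrB pi_sum mu_sum subrr.
  by rewrite !mxE => /eqP; rewrite subr_eq0 => /eqP.
have -> : pi = mu by apply/rowP => i; rewrite piE mxE.
split; last by [].
exact: (invariant_sum1_ge0 leap_P_ge0 leap_P_sum1 leap_P_down).
Qed.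

End Chain.

Theorem mainTheorem7 (C : numClosedFieldType) (k : nat) (p q : nat -> C)
  (N : nat) (ys : seq C) :
  (0 < k)%N ->
  (forall l, (1 <= l <= k)%N -> 0 <= p l) ->
  (forall l, (1 <= l <= k)%N -> 0 <= q l) ->
  \sum_(1 <= l < k.+1) (p l + q l) = 1 ->
  0 < \sum_(1 <= l < k.+1) p l ->
  0 < \sum_(1 <= l < k.+1) q l ->
  \big[gcdn/0%N]_(1 <= j < k.+1 | 0 < p j + q j) j = 1%N ->
  (kp k p + kq k q <= N)%N ->
  (* ys = y_1,...,y_s : the distinct nonzero roots of psi, ascending |.| *)
  uniq ys ->
  (forall y, y \in ys -> y != 0 /\ root (psi k p q) y) ->
  (forall y, y != 0 -> root (psi k p q) y -> y \in ys) ->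
  sorted (fun a b => `|a| <= `|b|) ys ->
  let W := Wmx k p q N ys in
  let S := \sum_(j < N.+1) \det (W j) in
  S != 0 /\
  (forall pi : 'rV[C]_(N.+1),
     stationary k p q pi <-> (forall i : 'I_(N.+1), pi 0 i = \det (W i) / S)).
Proof.
move=> k_gt0 p_ge0 q_ge0 pq_sum1 p_sum q_sum _ leN uniq_ys ys_root root_ys _ W S.
have [kp_gt0 _ _ _] := kp_support p_ge0 p_sum.
by apply: det_Wmx_stationary => //; apply: leq_trans leN; rewrite addn_gt0 kp_gt0.
Qed.
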